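(* Let $G$ be a finite $p$-group of nilpotence class two, for $p>2$ a prime. Let $p^r=\exp(G/Z(G))$. Then $T(G)$ contains a cyclic subgroup of order $\varphi(p^r)=(p-1)p^{r-1}$. In particular, $T(G)$ contains an element of order $p-1$.
   Context: For a group $G$, $S(G)$ is the group of permutations of the set $G$. Let $\rho:G\to S(G)$, $\rho(g):h\mapsto hg$, be the right regular representation. Put $\operatorname{Hol}(G)=N_{S(G)}(\rho(G))=\operatorname{Aut}(G)\rho(G)$, $\operatorname{NHol}(G)=N_{S(G)}(\operatorname{Hol}(G))$ and $T(G)=\operatorname{NHol}(G)/\operatorname{Hol}(G)$. Here $\exp$ denotes the exponent of a group and $\varphi$ is Euler's totient function. *)

(* Defs.v *)
From mathcomp Require Import all_boot all_fingroup all_solvable.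

Set Implicit Arguments.
Unset Strict Implicit.
Unset Printing Implicit Defensive.

Local Open Scope group_scope.

(* The group G is the full type gT, so S(G) is {perm gT}. Products in
   {perm gT} are read from left to right: (s * t) x = t (s x). *)

Definition right_regular (gT : finGroupType) (g : gT) : {perm gT} :=
  actperm 'R g.

Lemma right_regularE (gT : finGroupType) (g h : gT) :
  right_regular g h = h * g.
Proof. by rewrite /right_regular actpermE. Qed.

Definition Hol (gT : finGroupType) : {group {perm gT}} :=
  'N([set right_regular g | g : gT])%G.

Definition NHol (gT : finGroupType) : {group {perm gT}} := 'N(Hol gT)%G.

Definition T_group (gT : finGroupType) : {group coset_of (Hol gT)} :=
  (NHol gT / Hol gT)%G.

(* Main.v *)
Require Import Defs.
From mathcomp Require Import all_boot all_fingroup all_solvable.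
From mathcomp Require Import ssralg zmodp.

Set Implicit Arguments.
Unset Strict Implicit.
Unset Printing Implicit Defensive.

(** The cyclic subgroup comes from the power maps [x |-> x ^+ d], with [d]
prime to [p].  Since [p] is odd, [d] may be taken odd, say [d = 2m + 1], and
then nilpotency class two gives the symmetric power formula

   [(x * y) ^+ d = y ^+ m * x ^+ d * y ^+ m.+1]     ([class2_expMg]),

on which everything rests.

An element of [Hol gT] has the form [x |-> a x * c] with [a] an automorphism.
Power maps commute with automorphisms, so by the formula conjugation by the
[d]-th power map turns this element into [x |-> c ^+ m * a x * c ^+ m.+1],
again an automorphism (an inner one composed with [a]) followed by a
translation.  So odd power maps lie in [NHol gT] ([expg_perm_NHol]).

An element of [Hol gT] fixing [1] is an automorphism, and by the formula the
[d]-th power map is multiplicative exactly when all [y ^+ m] are central,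
i.e. when [exp(G/Z(G)) = p ^ r] divides [m], or equivalently [d - 1]
([expg_perm_Hol]).  Since power maps compose by multiplying exponents, the
class in [T_group gT] of the [d]-th power map has the same order as [d] in
the units modulo [p ^ r]; a primitive root [d] makes this order
[totient (p ^ r)]. *)

Local Open Scope group_scope.

(** A map [x |-> a x * c] with [a] multiplicative has [c = s 1] and
[a x = s x * (s 1)^-1]; the identity below is the multiplicativity of this
[a], which makes membership in the holomorph checkable pointwise. *)
Lemma HolP (gT : finGroupType) (s : {perm gT}) :
  reflect (forall x y, s (x * y) = s x * (s 1)^-1 * s y) (s \in Hol gT).
Proof.
rewrite inE; apply: (iffP subsetP) => [nRs x y | sM t].
  (* s turns right translation by y into right translation by some g; the
     value g = (s 1)^-1 * s y is read off at the point 1. *)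
  have /nRs/imsetP[g _ def_g]: right_regular y ^ s
      \in [set right_regular g | g : gT] :^ s.
    by rewrite memJ_conjg imset_f.
  have sMg z : s (z * y) = s z * g.
    by rewrite -(right_regularE g) -def_g !permM permK right_regularE.
  by rewrite -[in s y](mul1g y) !sMg -!mulgA mulKg.
case/imsetP=> _ /imsetP[y _ ->] ->{t}.
apply/imsetP; exists ((s 1)^-1 * s y) => //; apply/permP=> x.
by rewrite !permM !right_regularE sM permKV mulgA.
Qed.

Lemma class2_commg_commute (gT : finGroupType) (x y z : gT) :
  nil_class [set: gT] <= 2 -> commute z [~ x, y].
Proof.
rewrite nil_class2 => /subsetP/(_ [~ x, y]) => sGZ.
have /centerP[_ cxy] := sGZ (mem_commg (in_setT x) (in_setT y)).
exact/esym/cxy.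
Qed.

(** In class two, [(x * y) ^+ n = x ^+ n * y ^+ n * [~ y, x] ^+ 'C(n, 2)].
For [n = 2m + 1] the binomial coefficient is [m * n], so by bilinearity the
correction term is the single commutator [[~ y ^+ m, x ^+ n]], which moves
[y ^+ m] to the left of [x ^+ n]. *)
Lemma class2_expMg (gT : finGroupType) (x y : gT) m :
  nil_class [set: gT] <= 2 ->
  (x * y) ^+ m.*2.+1 = y ^+ m * x ^+ m.*2.+1 * y ^+ m.+1.
Proof.
move=> cl2; have cR u v w := class2_commg_commute u v w cl2.
rewrite expMg_Rmul //.
have ->: [~ y, x] ^+ 'C(m.*2.+1, 2) = [~ y ^+ m, x ^+ m.*2.+1].
  rewrite commXXg //; congr (_ ^+ _).
  by rewrite bin2 /= mulnC -doubleMl doubleK.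
have cyR := cR (y ^+ m) (x ^+ m.*2.+1) (y ^+ m.+1).
rewrite [in RHS](commgC (y ^+ m)); set c := [~ _, _] in cyR *.
rewrite -(mulgA _ c) -{}cyR; move: c => c; rewrite !mulgA; congr (_ * c).
by rewrite -!mulgA -expgD addnS addnn.
Qed.

(** Writing [t] in [Hol gT] as [x |-> a x * c], the power formula computes
[(a x * c) ^+ (2m + 1)] and shows that [t ^ s] is
[x |-> c ^+ m * a x * c ^+ m.+1]. *)
Lemma expg_perm_NHol (gT : finGroupType) (s : {perm gT}) m :
  nil_class [set: gT] <= 2 -> s =1 (fun x => x ^+ m.*2.+1) -> s \in NHol gT.
Proof.
move=> cl2 sE; rewrite inE; apply/subsetP=> _ /imsetP[t /HolP tM ->].
pose c := t 1; pose a x := t x * c^-1.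
have aM x y : a (x * y) = a x * a y by rewrite /a tM !mulgA.
have a1 : a 1 = 1 by rewrite /a mulgV.
have aX x n : a (x ^+ n) = a x ^+ n.
  by elim: n => // n IHn; rewrite !expgS aM IHn.
have tsE x : (t ^ s) x = c ^+ m * a x * c ^+ m.+1.
  rewrite -{1 2}(permKV s x) conjgE !permM permK (sE (t _)).
  rewrite -[t _](mulgKV c) -/(a _) (class2_expMg _ _ _ cl2).
  by rewrite -aX -sE permKV.
apply/HolP=> x y; rewrite !tsE aM a1 mulg1.
set u := c ^+ m; set v := c ^+ m.+1.
by rewrite invMg !mulgA mulgK mulgKV.
Qed.

(** Let [d = 2m + 1].  As [s] fixes [1], it lies in [Hol gT] only if it is multiplicative.
Comparing [x ^+ d * y ^+ d] with the power formula and cancelling [y ^+ m.+1],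
this says that [y ^+ m] commutes with every [x ^+ d], hence with every
element because [s] is surjective. *)
Lemma expg_perm_Hol (gT : finGroupType) (s : {perm gT}) m :
    nil_class [set: gT] <= 2 -> s =1 (fun x => x ^+ m.*2.+1) ->
  (s \in Hol gT) = (exponent ([set: gT] / 'Z([set: gT])) %| m).
Proof.
move=> cl2 sE.
have nZ (x : gT) : x \in 'N('Z([set: gT])).
  by apply: subsetP (in_setT x); apply: gFnorm.
transitivity [forall y, y ^+ m \in 'Z([set: gT])].
  apply/HolP/forallP=> [sM y | Zm x y].
    apply/centerP; split=> // z _; rewrite -(permKV s z).
    move: (s^-1 z) => x; apply: (mulIg (y ^+ m.+1)).
    rewrite sE -(class2_expMg _ _ _ cl2) -sE sM !sE expg1n invg1 mulg1.
    by rewrite -mulgA -expgD addnS addnn.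
  have /centerP[_ cym] := Zm y.
  rewrite !sE (class2_expMg _ _ _ cl2) cym // expg1n invg1 mulg1.
  by rewrite -mulgA -expgD addnS addnn.
apply/forallP/exponentP=> [Zm _ /morphimP[x Nx _ ->] | expZ x].
  by rewrite -morphX //; apply/coset_id/Zm.
apply: coset_idr => //; rewrite morphX //.
by apply: expZ; rewrite mem_quotient.
Qed.

Lemma expg_perm_exists (gT : finGroupType) d :
  coprime #|gT| d -> exists s : {perm gT}, s =1 (fun x => x ^+ d).
Proof.
rewrite -cardsT => cod.
have inj_d : injective (fun x : gT => x ^+ d).
  move=> x y /= eq_xy.
  by rewrite -(expgK cod (in_setT x)) eq_xy (expgK cod (in_setT y)).
by exists (perm inj_d) => x; rewrite permE.
Qed.

Lemma expg_permX (gT : finGroupType) (s : {perm gT}) d k :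
  s =1 (fun x => x ^+ d) -> s ^+ k =1 (fun x => x ^+ (d ^ k)).
Proof.
move=> sE; elim: k => [|k IHk] x; first by rewrite perm1.
by rewrite expgSr permM IHk sE expnSr expgM.
Qed.

(** The units modulo [p ^ r] form the automorphism group of the cyclic group
of order [p ^ r], which is cyclic for odd [p].  The root can be taken odd
because adding the odd number [p ^ r] changes the parity. *)
Lemma prime_power_primitive_root p r :
    prime p -> odd p -> 0 < r ->
  exists2 d, odd d & forall k, (d ^ k == 1 %[mod p ^ r]) = (totient (p ^ r) %| k).
Proof.
move=> p_pr p_odd r_gt0; have p_gt1 := prime_gt1 p_pr.
have q_gt1 : 1 < p ^ r by rewrite -(exp1n r) ltn_exp2r.
have oZ : #|Zp (p ^ r)| = (p ^ r)%N by rewrite card_Zp // ltnW.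
have pZ : p.-group (Zp (p ^ r)) by rewrite /pgroup oZ pnatX pnat_id.
have cZ : cyclic (Zp (p ^ r)).
  by rewrite /Zp q_gt1; apply/cyclicP; exists Zp1; apply: Zp_cycle.
have ntZ : Zp (p ^ r) != 1 :> {set _} by rewrite -cardG_gt1 oZ.
(* The map m sends an automorphism of the additive group to its multiplier. *)
have [m [[_ [m1 _] [inj_m _] mX _] [_ cycF _ _] defA]] :=
  cyclic_pgroup_Aut_structure pZ cZ ntZ.
have cycA : cyclic (Aut (Zp (p ^ r))).
  move: defA; case: ifP => [_ -> // | _ [t [_ _ _]]].
  by rewrite p_odd => -[[]].
have [a defa] := cyclicP cycA.
have Aa k : a ^+ k \in Aut (Zp (p ^ r)) by rewrite defa mem_cycle.
have Aa1 : a \in Aut (Zp (p ^ r)) := Aa 1%N.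
have oa : #[a] = totient (p ^ r).
  by rewrite orderE -defa card_Aut_cyclic // oZ.
have natE n : (n%:R : 'Z_#|Zp (p ^ r)|)%R = n %% p ^ r :> nat.
  by rewrite val_Zp_nat oZ.
have ma_root k : (m a ^ k == 1 %[mod p ^ r]) = (totient (p ^ r) %| k).
  rewrite -oa order_dvdn -(inj_in_eq inj_m) ?(Aa 0) ?Aa // m1 mX ?Aa1 //.
  rewrite -{2}[m a]natr_Zp -GRing.natrX -[1%R]/(1%:R)%R.
  by rewrite -(inj_eq (@ord_inj _)) !natE.
exists (if odd (m a) then m a : nat else m a + p ^ r) => [|k].
  by case: ifPn => // ma_even; rewrite oddD oddX p_odd orbT addbT.
by case: ifP => // _; rewrite -ma_root -modnXm modnDr modnXm.
Qed.

Local Close Scope group_scope.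

Theorem proposition3p1 (gT : finGroupType) (p r : nat) :
  prime p -> 2 < p ->
  (p.-group [set: gT])%g ->
  nil_class [set: gT] = 2 ->
  exponent ([set: gT] / 'Z([set: gT]))%g = p ^ r ->
  [/\ exists C : {group coset_of (Hol gT)},
        [/\ C \subset T_group gT, cyclic C & #|C| = totient (p ^ r)],
      totient (p ^ r) = (p - 1) * p ^ (r - 1)
    & exists2 x : coset_of (Hol gT), x \in T_group gT & #[x]%g = p - 1].
Proof.
move=> p_pr p_gt2 pG cl2 expG.
have cl_le2 : nil_class [set: gT] <= 2 by rewrite cl2.
have p_odd : odd p by case: (even_prime p_pr) p_gt2 => // ->.
have r_gt0 : 0 < r.
  rewrite lt0n; apply: contra_eqN expG => /eqP->; apply/eqP=> expG.
  have: [set: gT] \subset 'Z([set: gT])%g.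
    by rewrite -quotient_sub1 ?gFnorm // subG1 trivg_exponent expG.
  move/subset_trans/(_ (subsetIr _ _)).
  by rewrite -/(abelian _) -nil_class1 cl2.
have tot_q : totient (p ^ r) = ((p - 1) * p ^ (r - 1))%N.
  by rewrite totient_pfactor // !subn1.
have [d d_odd d_root] := prime_power_primitive_root p_pr p_odd r_gt0.
have co_pd : coprime p d.
  have tot_gt0 : 0 < totient (p ^ r) by rewrite totient_gt0 expn_gt0 prime_gt0.
  rewrite coprime_sym -(coprime_pexpl _ _ tot_gt0) -(coprime_pexpr _ _ r_gt0).
  have /eqP d1 : d ^ totient (p ^ r) == 1 %[mod p ^ r] by rewrite d_root.
  by rewrite -coprime_modl d1 coprime_modl coprime1n.
have [s sE] : exists s : {perm gT}, s =1 (fun x => (x ^+ d)%g).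
  have [n oG] := p_natP pG.
  by apply: expg_perm_exists; rewrite -cardsT oG coprimeXl.
have oddE n : odd n -> n = n./2.*2.+1.
  by move=> n_odd; rewrite -{1}(odd_double_half n) n_odd.
have sN : s \in NHol gT.
  by apply: (@expg_perm_NHol _ _ d./2) => // x; rewrite sE {1}(oddE d).
pose x := coset (Hol gT) s.
have xT : x \in T_group gT by rewrite mem_quotient.
have ox_dvd k : (#[x]%g %| k) = (totient (p ^ r) %| k).
  have dk_odd : odd (d ^ k) by rewrite oddX d_odd orbT.
  transitivity ((s ^+ k)%g \in Hol gT).
    rewrite order_dvdn -morphX //.
    apply/eqP/idP => [|/coset_id //]; apply: coset_idr.
    by rewrite groupX.
  rewrite (@expg_perm_Hol _ _ (d ^ k)./2) // => [|y]; last first.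
    by rewrite (expg_permX _ sE) {1}(oddE (d ^ k)).
  rewrite expG -d_root eqn_mod_dvd ?odd_gt0 //.
  (* d ^ k - 1 is twice (d ^ k)./2, and 2 is prime to p ^ r. *)
  rewrite {2}(oddE _ dk_odd) subn1 /= -muln2 Gauss_dvdl //.
  by rewrite coprimeXl // coprimen2.
have ox : #[x]%g = totient (p ^ r).
  by apply/eqP; rewrite eqn_dvd ox_dvd dvdnn -ox_dvd /=.
split=> //.
  by exists <[x]>%G; rewrite cycle_subG xT cycle_cyclic -orderE ox.
exists (x ^+ (p ^ (r - 1)))%g; first by rewrite groupX.
by rewrite orderXdiv ox tot_q ?dvdn_mull // mulnK // expn_gt0 prime_gt0.
Qed.
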